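(* Let $n\ge 1$ be an integer and let $K=\{123,132,213,231\}$. The number of equivalence classes of $S_n$ under $K$-equivalence is $n$.
   Context: Permutations in $S_n$ are written as words $\pi_1\pi_2\cdots\pi_n$ in one-line notation. The order permutation of a word $u$ of $c$ distinct positive integers is the unique $\sigma\in S_c$ with $\sigma_i<\sigma_j$ iff $u_i<u_j$. A replacement partition $K$ of $S_c$ is a set partition of $S_c$; it is denoted by listing its parts with the one-element parts (and outer brackets) omitted, so here $K$ is the set partition of $S_3$ whose only part of size greater than one is $\{123,132,213,231\}$. The $K$-equivalence on $S_n$ is the equivalence relation generated by: $\phi\equiv\psi$ whenever $\phi=aub$ and $\psi=avb$ (concatenations) for some possibly empty words $a,b$ and words $u,v$ of length $c$ (so $u,v$ occupy the same $c$ consecutive positions) such that the order permutations of $u$ and $v$ lie in the same part of $K$. All equivalence classes are counted, including one-element classes. *)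

(* Defs.v *)
From mathcomp Require Import all_boot all_fingroup.
Set Implicit Arguments.
Unset Strict Implicit.
Unset Printing Implicit Defensive.

(* 'S_n permutes {0, ..., n-1}; the one-line word uses the letters 1, ..., n. *)
Definition oneline n (s : 'S_n) : seq nat := [seq (s i).+1 | i <- enum 'I_n].

Definition is_order_perm c (u : seq nat) (sigma : 'S_c) : bool :=
  (size u == c) &&
  [forall i : 'I_c, forall j : 'I_c,
     (sigma i < sigma j) == (nth 0 u i < nth 0 u j)].

(* The set partition of 'S_c given by the listed parts Q, every permutation
   in no listed part forming a part by itself. *)
Definition replacement_partition c (Q : {set {set 'S_c}}) : {set {set 'S_c}} :=
  Q :|: [set [set s] | s in ~: cover Q].

Lemma replacement_partitionP c (Q : {set {set 'S_c}}) :
  set0 \notin Q -> trivIset Q ->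
  partition (replacement_partition Q) [set: 'S_c].
Proof.
move=> Q0 tQ; apply/and3P; split.
- apply/eqP/setP=> s; rewrite inE; apply/bigcupP.
  case: (boolP (s \in cover Q)) => [/bigcupP[B QB Bs]|sQ].
    by exists B => //; rewrite inE QB.
  exists [set s]; rewrite ?set11 // inE; apply/orP; right.
  by apply/imsetP; exists s; rewrite // inE.
- apply/trivIsetP=> A B; rewrite !inE => /orP[QA|/imsetP[s + ->]].
    move=> /orP[QB|/imsetP[t + ->]]; first exact: (trivIsetP tQ).
    rewrite inE => tnQ _; rewrite disjoint_sym disjoints1.
    by apply: contra tnQ => At; apply/bigcupP; exists A.
  rewrite inE => snQ /orP[QB|/imsetP[t _ ->]].
    by rewrite disjoints1 => _; apply: contra snQ => Bs; apply/bigcupP; exists B.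
  by rewrite disjoints1 inE => nst; apply: contra nst => /eqP ->.
- rewrite inE negb_or Q0; apply/imsetP=> -[s _ /setP/(_ s)].
  by rewrite !inE eqxx.
Qed.

(* Boolean form of a single replacement, at the c positions i, ..., i+c-1;
   replace_stepP gives it in terms of factorizations a ++ u ++ b. *)
Definition replace_step c (K : {set {set 'S_c}}) n : rel 'S_n :=
  fun phi psi =>
  [exists i : 'I_n.+1,
    let a w := take i w in
    let u w := take c (drop i w) in
    let b w := drop c (drop i w) in
    [&& a (oneline phi) == a (oneline psi),
        b (oneline phi) == b (oneline psi) &
        [exists B in K, exists sigma in B, exists tau in B,
          is_order_perm (u (oneline phi)) sigma &&
          is_order_perm (u (oneline psi)) tau]]].

Lemma replace_stepP c (K : {set {set 'S_c}}) n (phi psi : 'S_n) :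
  reflect
    (exists a u v b : seq nat,
       [/\ oneline phi = a ++ u ++ b, oneline psi = a ++ v ++ b,
           size u = c, size v = c &
           exists (B : {set 'S_c}) (sigma tau : 'S_c),
             [/\ B \in K, sigma \in B, tau \in B,
                 is_order_perm u sigma & is_order_perm v tau]])
    (replace_step K phi psi).
Proof.
apply: (iffP existsP) => [[i /and3P[/eqP ea /eqP eb]]|].
  move=> /exists_inP[B KB /exists_inP[s Bs /exists_inP[t Bt /andP[us vt]]]].
  exists (take i (oneline phi)), (take c (drop i (oneline phi))),
    (take c (drop i (oneline psi))), (drop c (drop i (oneline phi))); split.
  - by rewrite !cat_take_drop.
  - by rewrite ea eb !cat_take_drop.
  - by case/andP: us => /eqP.
  - by case/andP: vt => /eqP.
  - by exists B, s, t.
move=> [a [u [v [b [ephi epsi su sv [B [s [t [KB Bs Bt us vt]]]]]]]]].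
have sa : size a < n.+1.
  have := congr1 size ephi; rewrite !size_cat size_map size_enum_ord => ->.
  by rewrite ltnS leq_addr.
exists (Ordinal sa); rewrite ephi epsi /= !take_size_cat // !drop_size_cat //.
rewrite !take_size_cat // !eqxx /=.
apply/exists_inP; exists B => //; apply/exists_inP; exists s => //.
by apply/exists_inP; exists t; rewrite ?us.
Qed.

Lemma replace_step_sym c (K : {set {set 'S_c}}) n :
  symmetric (@replace_step c K n).
Proof.
suff sub phi psi : @replace_step c K n phi psi -> @replace_step c K n psi phi.
  by move=> phi psi; apply/idP/idP; apply: sub.
move=> /replace_stepP[a [u [v [b [? ? ? ? [B [s [t [? ? ? ? ?]]]]]]]]].
by apply/replace_stepP; exists a, v, u, b; split=> //; exists B, t, s.
Qed.

(* replace_step being symmetric, its reflexive transitive closure is the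
   equivalence relation it generates. *)
Definition Kequiv c (K : {set {set 'S_c}}) n : rel 'S_n :=
  connect (@replace_step c K n).

Lemma Kequiv_equivalence c (K : {set {set 'S_c}}) n :
  equivalence_rel (@Kequiv c K n).
Proof.
apply/equivalence_relP; split=> [s|s t st r]; first exact: connect0.
by apply: same_connect => //; apply/sym_connect_sym/replace_step_sym.
Qed.

Definition Kclasses c (K : {set {set 'S_c}}) n : {set {set 'S_n}} :=
  equivalence_partition (@Kequiv c K n) [set: 'S_n].

Definition perms_of_words c (ws : seq (seq nat)) : {set 'S_c} :=
  [set s : 'S_c | oneline s \in ws].

Definition K_123_132_213_231 : {set {set 'S_3}} :=
  replacement_partition
    [set perms_of_words 3
       [:: [:: 1; 2; 3]; [:: 1; 3; 2]; [:: 2; 1; 3]; [:: 2; 3; 1]]].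

(* Main.v *)
Require Import Defs.
From mathcomp Require Import all_boot all_fingroup.

Set Implicit Arguments.
Unset Strict Implicit.
Unset Printing Implicit Defensive.

(** The large part of the partition consists of the permutations of three
    letters that do not start with their largest letter; 312 and 321 form parts
    by themselves.  So a replacement that changes the word rearranges three
    consecutive letters, the largest of which comes first neither before nor
    after.

    If the largest letter of a word comes first it can never move, and if it
    does not come first it can never become first.  Stripping a leading largest
    letter and repeating, one gets an invariant [peel]: the number of letters
    that can be removed successively from the front, each being the largest of
    those remaining, where the last letter is not counted
    ([replace_step_peel]).

    This invariant is complete ([peel_wequiv]).  Once the leading largest
    letters are stripped, it suffices that any two words on the same letters,
    neither starting with its largest letter, are equivalent
    ([wequiv_head_maxN]).  By induction on the length, this follows from
    [wequiv_push_max], which brings the largest letter to the end while leaving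
    in front of it a word that again does not start with its largest letter
    (or has a single letter).

    Since [peel] takes exactly the values [0, ..., n - 1] on permutations of
    [n >= 1] letters, there are [n] classes. *)

(** * Words whose first letter is largest *)

(** The first letter of [w] is at least every other one; the empty word
    qualifies by convention. *)
Definition head_max (w : seq nat) : bool :=
  if w is x :: s then all (leq^~ x) s else true.

(** The number of letters that can be stripped one by one from the front of
    [w], each being the largest of the letters still present.  The last
    remaining letter is not counted, so that the values on nonempty words of
    length [n] are exactly [0, ..., n - 1]. *)
Fixpoint peel (w : seq nat) : nat :=
  if w is x :: s then
    if (s != [::]) && all (leq^~ x) s then (peel s).+1 else 0
  else 0.

Lemma head_maxE u c : size u = c ->
  head_max u = [forall j : 'I_c, ~~ (nth 0 u 0 < nth 0 u j)].
Proof.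
move=> <-; apply/idP/forallP => [hu j|].
  case: u j hu => [[]//|x s] [[|j] /= jlt] hs; first by rewrite ltnn.
  by rewrite -leqNgt; apply: (allP hs); rewrite mem_nth.
case: u => // x s hs; apply/(all_nthP 0) => j js.
have jlt : j.+1 < size (x :: s) by [].
by have := hs (Ordinal jlt); rewrite -leqNgt.
Qed.

(** A block that does not start with its largest letter stops the stripping,
    whatever follows it. *)
Lemma peel_head_maxN u b : ~~ head_max u -> peel (u ++ b) = 0.
Proof.
case: u => //= x s hs.
by rewrite all_cat (negbTE hs) andbF.
Qed.

Lemma peel_cat a w w' : perm_eq w w' -> peel w = peel w' ->
  peel (a ++ w) = peel (a ++ w').
Proof.
move=> pww eww; elim: a => //= x a ->.
have paw : perm_eq (a ++ w) (a ++ w') by rewrite perm_cat2l.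
by rewrite (perm_all _ paw) -!size_eq0 (perm_size paw).
Qed.

Lemma peel_lt_size w : w != [::] -> peel w < size w.
Proof.
elim: w => //= x s IH _; case: ifP => // /andP[s0 _].
by rewrite ltnS IH.
Qed.

Lemma peel_surj n k : k < n -> exists2 w, perm_eq w (iota 1 n) & peel w = k.
Proof.
elim: n k => // n IH [_|k]; last rewrite ltnS => kn.
  exists (iota 1 n.+1) => //=.
  by case: n {IH} => [|n] //=; rewrite ltnn.
have [w pw <-] := IH k kn; exists (n.+1 :: w).
  have -> : iota 1 n.+1 = rcons (iota 1 n) n.+1.
    by rewrite -[X in iota 1 X]addn1 iotaD add1n cats1.
  by rewrite perm_sym perm_rcons perm_cons perm_sym.
rewrite /= -size_eq0 (perm_size pw) size_iota -lt0n (leq_ltn_trans _ kn) //=.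
rewrite (perm_all _ pw); case: allP => // -[] y.
by rewrite mem_iota add1n ltnS => /andP[_ /leqW].
Qed.

(** * Rewriting words *)

(** The equivalence of words obtained by rearranging three consecutive
    letters, neither arrangement starting with its largest letter. *)
Inductive wequiv : seq nat -> seq nat -> Prop :=
| wequiv_refl w : wequiv w w
| wequiv_step a u v b w :
    size u = 3 -> perm_eq u v -> ~~ head_max u -> ~~ head_max v ->
    wequiv (a ++ v ++ b) w -> wequiv (a ++ u ++ b) w.

Lemma wequiv_trans w2 w1 w3 : wequiv w1 w2 -> wequiv w2 w3 -> wequiv w1 w3.
Proof.
elim=> // a u v b w su puv hu hv _ IH /IH.
exact: wequiv_step.
Qed.

Lemma wequiv_sym w1 w2 : wequiv w1 w2 -> wequiv w2 w1.
Proof.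
elim=> [w|a u v b w su puv hu hv _ IH]; first exact: wequiv_refl.
apply: (wequiv_trans IH); apply: (@wequiv_step a v u b) => //.
- by rewrite -(perm_size puv).
- by rewrite perm_sym.
- exact: wequiv_refl.
Qed.

Lemma wequiv_perm w1 w2 : wequiv w1 w2 -> perm_eq w1 w2.
Proof.
elim=> // a u v b w _ puv _ _ _; apply: perm_trans.
by rewrite perm_cat2l perm_cat2r.
Qed.

Lemma wequiv_cat c d w1 w2 : wequiv w1 w2 -> wequiv (c ++ w1 ++ d) (c ++ w2 ++ d).
Proof.
elim=> [w|a u v b w su puv hu hv _]; first exact: wequiv_refl.
by rewrite -!catA !(catA c a); apply: wequiv_step.
Qed.

Lemma wequiv_cons x w1 w2 : wequiv w1 w2 -> wequiv (x :: w1) (x :: w2).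
Proof. by move=> /(@wequiv_cat [:: x] [::]); rewrite !cats0. Qed.

Lemma wequiv_rcons x w1 w2 : wequiv w1 w2 -> wequiv (rcons w1 x) (rcons w2 x).
Proof. by rewrite -!cats1 => /(@wequiv_cat [::] [:: x]). Qed.

(** A letter [M] that is larger than all the following ones, and is preceded by
    a smaller letter, can be moved to the end. *)
Lemma wequiv_slide x M q : x < M -> all (fun y => y < M) q ->
  wequiv (x :: M :: q) (x :: rcons q M).
Proof.
elim: q x => [|y q IH] x xM /=; first by move=> _; apply: wequiv_refl.
move=> /andP[yM qM].
apply: (@wequiv_step [::] [:: x; M; y] [:: x; y; M] q) => //=.
- by rewrite (perm_cat2l [:: x]) (perm_catC [:: M] [:: y]).
- by rewrite negb_and -ltnNge xM.
- by rewrite andbT negb_and -!ltnNge xM orbT.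
- exact/wequiv_cons/IH.
Qed.

Lemma uniq_max_split w : uniq w -> w != [::] ->
  exists p M q, [/\ w = p ++ M :: q, all (fun y => y < M) p & all (fun y => y < M) q].
Proof.
elim: w => // x s IH /= /andP[xs us] _.
have [-> |s0] := eqVneq s [::]; first by exists [::], x, [::].
have [p [M [q [es hp hq]]]] := IH us s0.
have [xM|Mx|exM] := ltngtP x M.
- by exists (x :: p), M, q; rewrite es /= xM.
- exists [::], x, s; split=> //; rewrite es all_cat /= Mx.
  have sub r : all (fun y => y < M) r -> all (fun y => y < x) r.
    by apply: sub_all => y yM; apply: ltn_trans Mx.
  by rewrite !sub.
- by rewrite exM es mem_cat inE eqxx orbT in xs.
Qed.

(** When the letters other than the largest one, [M], form a word starting with
    its largest letter, they are rearranged to avoid this; that makes the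
    induction of [wequiv_head_maxN] possible. *)
Lemma wequiv_push_max w : uniq w -> ~~ head_max w ->
  exists M u, [/\ wequiv w (rcons u M), all (fun y => y < M) u &
                  ~~ head_max u || (size u == 1)].
Proof.
move=> uw hw.
have w0 : w != [::] by apply: contra hw => /eqP->.
have [p [M [q [ew hp hq]]]] := uniq_max_split uw w0.
case: p ew hp => [|x p] ew hp.
  move: hw; rewrite ew /= (sub_all _ hq) // => y; exact: ltnW.
have {}ew : wequiv w (rcons (x :: p ++ q) M).
  rewrite ew -[x :: p ++ q]cat_cons rcons_cat lastI !cat_rcons.
  have := @wequiv_slide (last x p) M q.
  move=> /(_ (allP hp _ (mem_last x p)) hq)/(@wequiv_cat (belast x p) [::]).
  by rewrite !cats0.
have {hp hq} hu : all (fun y => y < M) (x :: p ++ q) by rewrite -cat_cons all_cat hp.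
have {uw} uu : uniq (x :: p ++ q).
  by move: uw; rewrite (perm_uniq (wequiv_perm ew)) rcons_uniq => /andP[].
case: (p ++ q) ew hu uu => [|y t] ew hu uu; first by exists M, [:: x].
have [hxyt|] := boolP (head_max [:: x, y & t]); last first.
  by move=> hxyt; exists M, [:: x, y & t]; rewrite hxyt.
have /= /and3P[xM yM tM] := hu.
have yx : y < x.
  move: hxyt uu; rewrite /= inE negb_or => /andP[yx _] /andP[/andP[xy _] _].
  by rewrite ltn_neqAle eq_sym xy.
(* The second largest letter [x] leads: [M] is brought back next to it, the
   block [x M y] is rearranged into [y x M], and [M] slides to the end again. *)
exists M, [:: y, x & t]; split; rewrite /= ?yM ?xM ?tM //; last first.
  by rewrite leqNgt yx.
apply: (wequiv_trans ew); apply: wequiv_trans.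
  by apply: wequiv_sym; apply: (@wequiv_slide x M (y :: t)) => //=; rewrite yM.
apply: (@wequiv_step [::] [:: x; M; y] [:: y; x; M] t) => //=.
- by rewrite (perm_catC [:: x; M] [:: y]).
- by rewrite negb_and -ltnNge xM.
- by rewrite andbT negb_and -!ltnNge yM orbT.
- exact/wequiv_cons/wequiv_slide.
Qed.

Lemma wequiv_head_maxN w1 w2 : uniq w1 -> perm_eq w1 w2 ->
  ~~ head_max w1 -> ~~ head_max w2 -> wequiv w1 w2.
Proof.
have [m] := ubnP (size w1); elim: m w1 w2 => // m IH w1 w2 sm u1 p12 h1 h2.
have u2 : uniq w2 by rewrite -(perm_uniq p12).
have [M1 [v1 [e1 a1 c1]]] := wequiv_push_max u1 h1.
have [M2 [v2 [e2 a2 c2]]] := wequiv_push_max u2 h2.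
have pv : perm_eq (rcons v1 M1) (rcons v2 M2).
  apply: perm_trans (wequiv_perm e2); apply: perm_trans p12.
  by rewrite perm_sym; apply: wequiv_perm.
have eM : M1 = M2.
  have : M1 \in rcons v2 M2 by rewrite -(perm_mem pv) mem_rcons mem_head.
  have : M2 \in rcons v1 M1 by rewrite (perm_mem pv) mem_rcons mem_head.
  rewrite !mem_rcons !inE => /orP[/eqP//|/(allP a1) lt21].
  move=> /orP[/eqP//|/(allP a2) lt12].
  by have := ltn_trans lt21 lt12; rewrite ltnn.
subst M2; apply: (wequiv_trans e1); apply: wequiv_trans (wequiv_sym e2).
apply: wequiv_rcons.
have {}pv : perm_eq v1 v2.
  by rewrite -(perm_cat2r [:: M1]) !cats1.
have sv : size v1 < m.
  by have := perm_size (wequiv_perm e1); rewrite size_rcons => <-.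
have uv : uniq v1.
  by move: u1; rewrite (perm_uniq (wequiv_perm e1)) rcons_uniq => /andP[].
have [/eqP s1|s1] := boolP (size v1 == 1).
  case: v1 s1 pv {e1 a1 c1 sv uv} => [|x []] // _.
  rewrite perm_sym => /perm_small_eq -> //; exact: wequiv_refl.
apply: IH => //; first by rewrite (negbTE s1) orbF in c1.
by rewrite -(perm_size pv) (negbTE s1) orbF in c2.
Qed.

(** Equal values of [peel] imply equivalence, for words on the same letters. *)
Lemma peel_wequiv w1 w2 : uniq w1 -> perm_eq w1 w2 -> peel w1 = peel w2 ->
  wequiv w1 w2.
Proof.
elim: w1 w2 => [|x s IH] [|y t] uw pw.
- by move=> _; apply: wequiv_refl.
- by have := perm_size pw.
- by have := perm_size pw.
have [s0|s0] := leqP (size (x :: s)) 1.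
  rewrite perm_sym in pw.
  by rewrite (perm_small_eq s0 pw) => _; apply: wequiv_refl.
have sn0 : s != [::] by case: (s) s0.
have tn0 : t != [::] by rewrite (perm_size pw) in s0; case: (t) s0.
rewrite /= sn0 tn0 /=; case: ifP => hs; case: ifP => ht // est.
  have exy : x = y.
    have : x \in y :: t by rewrite -(perm_mem pw) mem_head.
    have : y \in x :: s by rewrite (perm_mem pw) mem_head.
    rewrite !inE => /orP[/eqP//|/(allP hs) yx] /orP[/eqP//|/(allP ht) xy].
    by apply/eqP; rewrite eqn_leq xy.
  subst y; apply: wequiv_cons; apply: IH.
  - by case/andP: uw.
  - by rewrite perm_cons in pw.
  - by case: est.
by apply: wequiv_head_maxN; rewrite ?hs ?ht //= ?hs ?ht.
Qed.

(** * One-line words and order permutations *)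

Lemma size_oneline n (s : 'S_n) : size (oneline s) = n.
Proof. by rewrite size_map size_enum_ord. Qed.

Lemma nth_oneline n (s : 'S_n) (i : 'I_n) : nth 0 (oneline s) i = (s i).+1.
Proof. by rewrite (nth_map i) ?size_enum_ord // nth_ord_enum. Qed.

Lemma oneline_inj n : injective (@oneline n).
Proof.
move=> s t est; apply/permP=> i; apply/val_inj.
by have := congr1 (fun w => nth 0 w i) est; rewrite !nth_oneline => -[].
Qed.

Lemma perm_oneline n (s : 'S_n) : perm_eq (oneline s) (iota 1 n).
Proof.
apply: uniq_perm; rewrite ?iota_uniq //.
  by rewrite map_inj_uniq ?enum_uniq // => i j [/val_inj/perm_inj].
move=> x; rewrite mem_iota add1n ltnS; apply/mapP/andP => [[i _ ->] // | [x0 xn]].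
have xlt : x.-1 < n by rewrite prednK.
exists (s^-1%g (Ordinal xlt)); first by rewrite mem_enum.
by rewrite permKV /= prednK.
Qed.

Lemma uniq_oneline n (s : 'S_n) : uniq (oneline s).
Proof. by rewrite (perm_uniq (perm_oneline s)) iota_uniq. Qed.

Lemma oneline_surj n w : perm_eq w (iota 1 n) -> exists s : 'S_n, oneline s = w.
Proof.
move=> pw.
have sw : size w = n by rewrite (perm_size pw) size_iota.
have uw : uniq w by rewrite (perm_uniq pw) iota_uniq.
have wP (i : 'I_n) : 0 < nth 0 w i <= n.
  have : nth 0 w i \in w by rewrite mem_nth ?sw.
  by rewrite (perm_mem pw) mem_iota add1n ltnS.
have lt_w (i : 'I_n) : (nth 0 w i).-1 < n.
  by have /andP[w0 wn] := wP i; rewrite prednK.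
have inj_w : injective (fun i => Ordinal (lt_w i)).
  move=> i j [eij]; apply/val_inj/eqP; rewrite -(nth_uniq 0 _ _ uw) ?sw ?ltn_ord //.
  have /andP[wi _] := wP i; have /andP[wj _] := wP j.
  by rewrite -(prednK wi) eij prednK.
exists (perm inj_w); apply: (@eq_from_nth _ 0); rewrite size_oneline ?sw //.
move=> i lt_i; rewrite (nth_oneline _ (Ordinal lt_i)) permE /= prednK //.
by case/andP: (wP (Ordinal lt_i)).
Qed.

(** The order permutation sends a position of [u] to the rank of its letter in
    the sorted word. *)
Lemma order_perm_exists c u : uniq u -> size u = c ->
  exists s : 'S_c, is_order_perm u s.
Proof.
move=> uu su.
have mem_u (i : 'I_c) : nth 0 u i \in sort leq u by rewrite mem_sort mem_nth ?su.
have lt_i (i : 'I_c) : index (nth 0 u i) (sort leq u) < c.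
  by rewrite -[X in _ < X]su -(size_sort leq) index_mem.
have inj_i : injective (fun i => Ordinal (lt_i i)).
  move=> i j [eij]; apply/val_inj/eqP; rewrite -(nth_uniq 0 _ _ uu) ?su ?ltn_ord //.
  by rewrite -(nth_index 0 (mem_u i)) eij nth_index.
exists (perm inj_i); rewrite /is_order_perm su eqxx /=.
apply/forallP=> i; apply/forallP=> j; rewrite !permE /=; apply/eqP.
have ss := sort_sorted leq_total u.
apply/idP/idP; last first.
  rewrite !ltnNge; apply: contra.
  by apply: (sorted_leq_index leq_trans leqnn ss).
move=> lt_ij; have := sorted_ltn_index leq_trans ss _ _ (mem_u i) (mem_u j) lt_ij.
rewrite leq_eqVlt => /orP[/eqP eij|//].
by rewrite eij ltnn in lt_ij.
Qed.

(** A word is determined by its letters and its order permutation: an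
    arrangement of positions that sorts [u] also sorts [v]. *)
Lemma order_perm_inj c u v (s : 'S_c) :
  perm_eq u v -> is_order_perm u s -> is_order_perm v s -> u = v.
Proof.
move=> puv /andP[/eqP su /forallP hu] /andP[/eqP sv /forallP hv].
have uv (i j : 'I_c) : (nth 0 u i <= nth 0 u j) = (nth 0 v i <= nth 0 v j).
  rewrite leqNgt [RHS]leqNgt; congr negb.
  by rewrite -(eqP (forallP (hu j) i)) -(eqP (forallP (hv j) i)).
pose r := sort (relpre (fun i : 'I_c => nth 0 u i) leq) (enum 'I_c).
have wE w : size w = c -> perm_eq [seq nth 0 w (val i) | i <- r] w.
  move=> sw; rewrite -[X in perm_eq _ X](mkseq_nth 0) sw /mkseq -val_enum_ord.
  by rewrite -map_comp; apply: perm_map; rewrite perm_sort.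
have su_r : sorted leq [seq nth 0 u (val i) | i <- r].
  by rewrite sorted_map sort_sorted // => i j; apply: leq_total.
have sv_r : sorted leq [seq nth 0 v (val i) | i <- r].
  rewrite sorted_map; move: su_r; rewrite sorted_map.
  by rewrite (eq_sorted (e' := relpre (fun i : 'I_c => nth 0 v (val i)) leq)).
have /eq_in_map e_r : [seq nth 0 u (val i) | i <- r] = [seq nth 0 v (val i) | i <- r].
  apply: (sorted_eq leq_trans anti_leq su_r sv_r).
  by rewrite (permPl (wE u su)) (permPl puv) perm_sym wE.
apply: (@eq_from_nth _ 0); rewrite su ?sv // => i lt_i.
by apply: (e_r (Ordinal lt_i)); rewrite mem_sort mem_enum.
Qed.

Lemma order_perm_head_max c u (s : 'S_c.+1) : is_order_perm u s ->
  head_max u = head_max (oneline s).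
Proof.
move=> /andP[/eqP su /forallP hu].
rewrite (head_maxE su) (head_maxE (size_oneline s)); apply: eq_forallb => j.
have s0 : nth 0 (oneline s) 0 = (s ord0).+1 := nth_oneline s ord0.
by rewrite s0 nth_oneline ltnS (eqP (forallP (hu ord0) j)).
Qed.

(** * The classes *)

Local Notation K := K_123_132_213_231.
Local Notation big_part := (perms_of_words 3
  [:: [:: 1; 2; 3]; [:: 1; 3; 2]; [:: 2; 1; 3]; [:: 2; 3; 1]]).

(** The large part: the permutations of three letters whose first letter is not
    the largest. *)
Lemma big_partE (s : 'S_3) : (s \in big_part) = ~~ head_max (oneline s).
Proof.
rewrite inE.
have /allP E : all (fun w => (w \in [:: [:: 1; 2; 3]; [:: 1; 3; 2]; [:: 2; 1; 3];
    [:: 2; 3; 1]]) == ~~ head_max w) (permutations [:: 1; 2; 3]) by [].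
by apply/eqP/E; rewrite mem_permutations perm_oneline.
Qed.

Lemma replace_step_peel n (s t : 'S_n) : replace_step K s t ->
  peel (oneline s) = peel (oneline t).
Proof.
move=> /replace_stepP[a [u [v [b [es et _ _ [B [p [q [KB Bp Bq up vq]]]]]]]]].
have puv : perm_eq u v.
  have : perm_eq (oneline s) (oneline t).
    by rewrite (permPl (perm_oneline s)) perm_sym perm_oneline.
  by rewrite es et perm_cat2l perm_cat2r.
rewrite es et; apply: peel_cat; first by rewrite perm_cat2r.
(* Either both blocks lie in the large part, or they have the same order
   permutation and are equal. *)
move: KB; rewrite !inE => /orP[/eqP eB|/imsetP[r _ eB]].
  move: Bp Bq; rewrite eB !big_partE.
  rewrite -(order_perm_head_max up) -(order_perm_head_max vq) => hu hv.
  by rewrite !peel_head_maxN.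
move: Bp Bq up vq; rewrite eB !inE => /eqP-> /eqP-> up vq.
by rewrite (order_perm_inj puv up vq).
Qed.

(** Rewriting the one-line word of a permutation passes only through one-line
    words of permutations, each step being a replacement. *)
Lemma wequiv_Kequiv n w1 w2 : wequiv w1 w2 -> forall s : 'S_n, oneline s = w1 ->
  exists2 t : 'S_n, oneline t = w2 & Kequiv K s t.
Proof.
elim=> [w s ew|a u v b w su puv hu hv _ IH s es].
  by exists s => //; apply: connect0.
have [t et] : exists t : 'S_n, oneline t = a ++ v ++ b.
  apply: oneline_surj; rewrite -(permPr (perm_oneline s)) es.
  by rewrite perm_cat2l perm_cat2r perm_sym.
have uu : uniq u.
  by move: (uniq_oneline s); rewrite es !cat_uniq => /and4P[_ _ ->].
have sv : size v = 3 by rewrite -(perm_size puv).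
have [p up] := order_perm_exists uu su.
have [q vq] : exists q : 'S_3, is_order_perm v q.
  by apply: order_perm_exists; rewrite // -(perm_uniq puv).
have [r er tr] := IH t et; exists r => //.
apply: connect_trans tr; apply/connect1/replace_stepP.
exists a, u, v, b; split=> //; exists big_part, p, q; split=> //.
- by rewrite !inE eqxx.
- by rewrite big_partE -(order_perm_head_max up).
- by rewrite big_partE -(order_perm_head_max vq).
Qed.

Lemma Kequiv_peel n (s t : 'S_n) :
  Kequiv K s t = (peel (oneline s) == peel (oneline t)).
Proof.
apply/idP/eqP => [/connectP[p]|est].
  by elim: p s => [|r p IH] s /= => [_ -> //|/andP[/replace_step_peel -> /IH]].
have pst : perm_eq (oneline s) (oneline t).
  by rewrite (permPl (perm_oneline s)) perm_sym perm_oneline.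
have [r /oneline_inj <- //] :=
  wequiv_Kequiv (peel_wequiv (uniq_oneline s) pst est) (erefl (oneline s)).
Qed.

(** The classes of the kernel of a surjection [f] are its fibres, as many as
    there are values. *)
Lemma card_kernel_partition (T I : finType) (R : rel T) (f : T -> I) :
  (forall x y, R x y = (f x == f y)) -> (forall i, exists x, f x = i) ->
  #|equivalence_partition R [set: T]| = #|I|.
Proof.
move=> Rf f_surj.
have -> : equivalence_partition R [set: T] = [set [set y | i == f y] | i : I].
  apply/setP=> B; apply/imsetP/imsetP => [[x _ ->]|[i _ ->]].
    by exists (f x) => //; apply/setP=> y; rewrite !inE Rf.
  have [x <-] := f_surj i; exists x => //.
  by apply/setP=> y; rewrite !inE Rf.
rewrite card_imset // => i j /setP eij.
by have [x fx] := f_surj i; have := eij x; rewrite !inE fx eqxx => /esym/eqP.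
Qed.

Unset Implicit Arguments.

Theorem proposition2p39 (n : nat) (hn : 1 <= n) :
  #|Kclasses K_123_132_213_231 n| = n.
Proof.
have lt_peel (s : 'S_n) : peel (oneline s) < n.
  have := @peel_lt_size (oneline s); rewrite -size_eq0 size_oneline -lt0n.
  exact.
rewrite -[RHS]card_ord.
apply: (card_kernel_partition (f := fun s => Ordinal (lt_peel s))) => [s t|i].
  exact: Kequiv_peel.
have [w pw wi] := peel_surj (ltn_ord i).
have [s es] := oneline_surj pw; exists s.
by apply: val_inj; rewrite /= es.
Qed.
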